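(* Let $A\in\mathbf R^{n\times n}$, $B\in\mathbf R^{n\times m}$, $C\in\mathbf R^{m\times n}$ be such that the system $(A,B,C)$ is invertible, and suppose $n_{\mathrm i}^*=n_{\mathrm i}^*(A,B,C)\ge 3$. Fix any choice of matrices $F_1,\dots,F_{n_{\mathrm i}^*}$, $F$, $R$ as described in the context, and let $R_1$, $S_i(L)$, $\Phi_{i\sim j}$, $\Psi_j$ be the matrices defined there. Suppose $L\in\mathbf R^{n\times m}$ satisfies $$\Phi_{(i+j)\sim n_{\mathrm i}^*}\,S_i(L)\,\Psi_j=0,\qquad j=1,2,\dots,n_{\mathrm i}^*-i,\quad i=2,3,\dots,n_{\mathrm i}^*-1 .$$ Then, for a nonsingular matrix $T_y\in\mathbf R^{m\times m}$, the system $(A+LC,B,T_yC)$ has a regular relative degree if and only if $$T_y=PUR_1$$ for some permutation matrix $P\in\mathbf R^{m\times m}$ and some matrix $U\in\mathbf R^{m\times m}$ that is block upper triangular $$U=\begin{bmatrix}U_1&*&\cdots&*\\ &U_2&\cdots&*\\ &&\ddots&\vdots\\ &&&U_{n_{\mathrm i}^*}\end{bmatrix},$$ with $U_i\in\mathbf R^{\psi_i\times\psi_i}$ nonsingular for $i=1,2,\dots,n_{\mathrm i}^*$, zeros below the diagonal blocks and arbitrary blocks $*$ above them.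
   Context: A system $(A,B,C)$ means $\dot x=Ax+Bu,\ y=Cx$ with $x\in\mathbf R^n$, $u,y\in\mathbf R^m$ and real constant matrices. Regular relative degree: let $c_1,\dots,c_m$ be the rows of $C$. The system $(A,B,C)$ has relative degree $\{r_1,\dots,r_m\}$ (ordered, $1\le r_i\le n$) if for each $i$, $c_iA^jB=0$ for $j=0,\dots,r_i-2$ and $c_iA^{r_i-1}B\ne0$. It is regular if the $m\times m$ coupling matrix with rows $c_1A^{r_1-1}B,\dots,c_mA^{r_m-1}B$ is nonsingular. ''Has a regular relative degree'' means the relative degree exists and is regular. Invertible: the transfer function $C(sI-A)^{-1}B$ has normal rank (maximal rank over $s\in\mathbf C$) equal to $m$. Invertibility matrices: for $i=1,\dots,n$, $Q_{\mathrm i}^{[i]}=Q_{\mathrm i}^{[i]}(A,B,C)\in\mathbf R^{mi\times mi}$ is the $i\times i$ block matrix whose $(j,k)$ block ($m\times m$) is $0$ if $j+k\le i$ and $CA^{j+k-i-1}B$ if $j+k\ge i+1$. Invertibility indices: $\varphi^{[1]}=\mathrm{rank}(Q_{\mathrm i}^{[1]})$, $\varphi^{[i]}=\mathrm{rank}(Q_{\mathrm i}^{[i]})-\mathrm{rank}(Q_{\mathrm i}^{[i-1]})$ for $i\ge2$. It is known that $\varphi^{[1]}\le\cdots\le\varphi^{[n]}$ and that the system is invertible iff $\varphi^{[n]}=m$. For an invertible system, $n_{\mathrm i}^*=\min\{i\in\{1,\dots,n\}:\varphi^{[i]}=m\}$. Put $\psi_1=\varphi^{[1]}$, $\psi_i=\varphi^{[i]}-\varphi^{[i-1]}\ge0$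 for $2\le i\le n_{\mathrm i}^*$, so that $\sum_{i=1}^{n_{\mathrm i}^*}\psi_i=m$. Write $\nu=n_{\mathrm i}^*$ below. Matrices $E_i$: in the reduced row-echelon form of $Q_{\mathrm i}^{[\nu]}$, with columns divided into $\nu$ blocks of width $m$, let $E_i$ be the $i$-th column block of those nonzero rows whose pivot lies in the $i$-th column block; thus the nonzero rows form a block upper-triangular matrix with diagonal blocks $E_1,\dots,E_\nu$. Each $E_i$ has $m$ columns, $\varphi^{[i]}$ rows and full row rank. Matrices $F_i$, $F$, $R$: choose $F_i\in\mathbf R^{\psi_i\times m}$ of rank $\psi_i$, $i=1,\dots,\nu$, with $\mathrm{im}(F_i^{\mathrm T})\setminus\{0\}\subseteq\mathrm{im}(E_i^{\mathrm T})\setminus\mathrm{im}(E_{i-1}^{\mathrm T})$, where $\mathrm{im}(E_0^{\mathrm T})=\{0\}$ (a matrix with zero rows has row space $\{0\}$). Then there is $R\in\mathbf R^{m\times m\nu}$ such that $RQ_{\mathrm i}^{[\nu]}=F$, where $F\in\mathbf R^{m\times m\nu}$ is block upper triangular (row blocks of heights $\psi_1,\dots,\psi_\nu$, column blocks of width $m$) with diagonal blocks $F_1,\dots,F_\nu$, zeros below them, and unspecified blocks above them. ($R$ and $F$ are not unique; fix any such choice.) Partition $R=[R_\nu\ \cdots\ R_2\ R_1]$ with $R_i\in\mathbf R^{m\times m}$; $R_1$ is nonsingular. Matrix $S(L)$: let $\Omega_{\mathrm o}^{[\nu]}(L)\in\mathbf R^{m\nu\times m\nu}$ be the block lower-triangular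 Toeplitz matrix with $(j,k)$ block $I_m$ if $j=k$, $-CA^{j-k-1}L$ if $j>k$, and $0$ if $j<k$. Define $S(L)=R\,\Omega_{\mathrm o}^{[\nu]}(L)\,(I_\nu\otimes R_1^{-1})\in\mathbf R^{m\times m\nu}$, partitioned as $S(L)=[S_\nu(L)\ \cdots\ S_3(L)\ S_2(L)\ I_m]$ with $S_i(L)\in\mathbf R^{m\times m}$. Selection matrices: $\psi_{i\sim j}=\sum_{k=i}^j\psi_k$ (equal to $0$ if $j<i$), and $\Phi_{i\sim j}=[\,0_{\psi_{i\sim j}\times\psi_{1\sim(i-1)}}\ \ I_{\psi_{i\sim j}}\ \ 0_{\psi_{i\sim j}\times\psi_{(j+1)\sim\nu}}\,]\in\mathbf R^{\psi_{i\sim j}\times m}$; $\Psi_i\in\mathbf R^{m\times\psi_i}$ is the matrix obtained by stacking $0_{\psi_{1\sim(i-1)}\times\psi_i}$, $I_{\psi_i}$, $0_{\psi_{(i+1)\sim\nu}\times\psi_i}$. Equations between empty matrices (zero rows or zero columns) hold vacuously, and blocks $U_i$ with $\psi_i=0$ are absent. *)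

(* Defs.v *)
From HB Require Import structures.
From mathcomp Require Import all_boot all_order all_algebra.
From mathcomp Require Import reals complex.

Set Implicit Arguments.
Unset Strict Implicit.
Unset Printing Implicit Defensive.

Import GRing.Theory.
Local Open Scope ring_scope.

(* Throughout, block numbers (of row blocks, column blocks, invertibility     *)
(* indices, psi_i, ...) are natural numbers starting at 1, whereas ordinals,  *)
(* and hence matrix entries and the indices of \mxblock, start at 0.          *)

Section Systems.
Variables (R : realType) (n m : nat).
Implicit Types (A : 'M[R]_n) (B L : 'M[R]_(n, m)) (C : 'M[R]_(m, n)).

Definition has_relative_degree A B C (r : 'I_m -> nat) : Prop :=
  forall i : 'I_m,
    [/\ (1 <= r i <= n)%N,
        forall j : nat, (j + 2 <= r i)%N -> row i C *m A ^+ j *m B = 0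
      & row i C *m A ^+ (r i).-1 *m B != 0].

Definition coupling_mx A B C (r : 'I_m -> nat) : 'M[R]_m :=
  \matrix_(i < m) (row i C *m A ^+ (r i).-1 *m B).

Definition has_regular_relative_degree A B C : Prop :=
  exists r : 'I_m -> nat,
    has_relative_degree A B C r /\ coupling_mx A B C r \in unitmx.

Definition cplx_mx p q (X : 'M[R]_(p, q)) : 'M[R[i]]_(p, q) :=
  map_mx (real_complex R) X.

(* The transfer function at s; meaningful when s is not an eigenvalue of A.   *)
Definition transfer A B C (s : R[i]) : 'M[R[i]]_m :=
  cplx_mx C *m invmx (s%:M - cplx_mx A) *m cplx_mx B.

Definition is_normal_rank A B C (k : nat) : Prop :=
  (exists2 s : R[i], s%:M - cplx_mx A \in unitmx & \rank (transfer A B C s) = k)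
  /\ (forall s : R[i], s%:M - cplx_mx A \in unitmx ->
        (\rank (transfer A B C s) <= k)%N).

Definition invertible A B C : Prop := is_normal_rank A B C m.

(* With the 1-based block numbers j.+1 and k.+1, the block is 0 if            *)
(* j.+1 + k.+1 <= i and C A^(j.+1 + k.+1 - i - 1) B otherwise.                *)
Definition Qi A B C (i : nat) : 'M[R]_(\sum_(j < i) m, \sum_(k < i) m) :=
  \mxblock_(j < i, k < i)
    (if (j.+1 + k.+1 <= i)%N then 0
     else C *m A ^+ (j.+1 + k.+1 - i - 1) *m B).

(* Qi A B C 0 is empty, so phi A B C 1 is the rank of Qi A B C 1; also        *)
(* phi A B C 0 = 0, so psi A B C 1 = phi A B C 1.  Both sequences             *)
(* i |-> \rank (Qi A B C i) and phi A B C are nondecreasing on 0, ..., n, so  *)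
(* the natural number subtractions do not truncate there.                     *)
Definition phi A B C (i : nat) : nat :=
  (\rank (Qi A B C i) - \rank (Qi A B C i.-1))%N.

Definition psi A B C (i : nat) : nat := (phi A B C i - phi A B C i.-1)%N.

Definition is_nistar A B C (nu : nat) : Prop :=
  [/\ (1 <= nu <= n)%N, phi A B C nu = m
    & forall i : nat, (1 <= i <= n)%N -> phi A B C i = m -> (nu <= i)%N].

Definition Omega_o A C L (nu : nat) :
    'M[R]_(\sum_(j < nu) m, \sum_(k < nu) m) :=
  \mxblock_(j < nu, k < nu)
    (if j == k then 1%:M
     else if (k < j)%N then - (C *m A ^+ (j - k - 1) *m L) else 0).

End Systems.

Section Echelon.
Variable R : realType.

Definition is_pivot p q (G : 'M[R]_(p, q)) (i : 'I_p) (j : 'I_q) : bool :=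
  (G i j != 0) && [forall j' : 'I_q, (j' < j)%N ==> (G i j' == 0)].

Definition is_rref p q (G : 'M[R]_(p, q)) : Prop :=
  [/\ forall i i' : 'I_p, (i < i')%N -> row i G = 0 -> row i' G = 0,
      forall (i i' : 'I_p) (j j' : 'I_q),
        (i < i')%N -> is_pivot G i j -> is_pivot G i' j' -> (j < j')%N,
      forall (i : 'I_p) (j : 'I_q), is_pivot G i j -> G i j = 1
    & forall (i i' : 'I_p) (j : 'I_q),
        is_pivot G i j -> i' != i -> G i' j = 0].

Definition is_rref_of p q (X G : 'M[R]_(p, q)) : Prop :=
  is_rref G /\ exists2 V : 'M[R]_p, V \in unitmx & G = V *m X.

(* k-th column block of width m, for 1 <= k <= nu. *)
Definition colblk p m nu (X : 'M[R]_(p, \sum_(k < nu) m)) (k : nat) :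
    'M[R]_(p, m) :=
  if [pick c : 'I_nu | c.+1 == k] is Some c then submxrow X c else 0.

(* Rows whose pivot lies in the i-th column block. *)
Definition pivot_rows p m nu (G : 'M[R]_(p, \sum_(k < nu) m)) (i : nat) :
    {set 'I_p} :=
  [set r | [exists c, is_pivot G r c && ((tagnat.sig1 c).+1 == i)]].

(* pivot_rows G 0 is empty, so Emx G 0 has no rows. *)
Definition Emx p m nu (G : 'M[R]_(p, \sum_(k < nu) m)) (i : nat) :
    'M[R]_(#|pivot_rows G i|, m) :=
  rowsub (fun a => enum_val a) (colblk G i).

End Echelon.

Section Selection.
Variables (R : realType) (m : nat) (ps : nat -> nat).

Definition psum (i j : nat) : nat := (\sum_(i <= k < j.+1) ps k)%N.

Definition Phi (i j : nat) : 'M[R]_(psum i j, m) :=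
  \matrix_(a, b) ((b : nat) == psum 1 i.-1 + a)%N%:R.

Definition Psi (i : nat) : 'M[R]_(m, ps i) :=
  \matrix_(a, b) ((a : nat) == psum 1 i.-1 + b)%N%:R.

(* Left multiplication by (Psi i)^T extracts the i-th row block (of height    *)
(* ps i), right multiplication by Psi k the k-th column block (of width ps k).*)
Definition rowblk q (i : nat) (X : 'M[R]_(m, q)) : 'M[R]_(ps i, q) :=
  (Psi i)^T *m X.

Definition blk (i k : nat) (U : 'M[R]_m) : 'M[R]_(ps i, ps k) :=
  rowblk i U *m Psi k.

Definition is_block_upper (nu : nat) (U : 'M[R]_m) : Prop :=
  (forall i k : nat, (1 <= k < i)%N -> (i <= nu)%N -> blk i k U = 0)
  /\ (forall i : nat, (1 <= i <= nu)%N -> blk i i U \in unitmx).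

End Selection.

Section Choice.
Variables (R : realType) (n m : nat).
Variables (A : 'M[R]_n) (B : 'M[R]_(n, m)) (C : 'M[R]_(m, n)) (nu : nat).

(* G is the reduced row-echelon form of Qi A B C nu. The space im(X^T) is the *)
(* row space of X, so v \in im(X^T) reads (v^T <= X)%MS.                      *)
Definition admissible_Fi (G : 'M[R]_(\sum_(j < nu) m, \sum_(k < nu) m))
    (Fd : forall i : nat, 'M[R]_(psi A B C i, m)) : Prop :=
  forall i : nat, (1 <= i <= nu)%N ->
    \rank (Fd i) = psi A B C i /\
    (forall v : 'rV[R]_m, (v <= Fd i)%MS -> v != 0 ->
       (v <= Emx G i)%MS /\ ~~ (v <= Emx G i.-1)%MS).

Definition admissible_FR (Fd : forall i : nat, 'M[R]_(psi A B C i, m))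
    (F Rm : 'M[R]_(m, \sum_(k < nu) m)) : Prop :=
  [/\ forall i : nat, (1 <= i <= nu)%N ->
        rowblk (psi A B C) i (colblk F i) = Fd i,
      forall i k : nat, (1 <= k < i)%N -> (i <= nu)%N ->
        rowblk (psi A B C) i (colblk F k) = 0
    & Rm *m Qi A B C nu = F].

(* The blocks are numbered from the right: [R_nu ... R_2 R_1]. *)
Definition rev_colblk (X : 'M[R]_(m, \sum_(k < nu) m)) (i : nat) : 'M[R]_m :=
  colblk X (nu + 1 - i).

Definition Smx (Rm : 'M[R]_(m, \sum_(k < nu) m)) (L : 'M[R]_(n, m)) :
    'M[R]_(m, \sum_(k < nu) m) :=
  Rm *m Omega_o A C L nu *m (\mxdiag_(k < nu) invmx (rev_colblk Rm 1)).

End Choice.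

(* Main.v *)
(* Work with Markov parameters, i.e. with expansions in 1/z.  The row space of *)
(* Emx G i consists of the leading coefficients x of the rows                 *)
(* r(z) C(zI-A)^-1 B = x z^-i + ..., so these spaces increase with i; with    *)
(* the choice of the F_i this makes their row spaces independent, hence       *)
(* psi_1 + ... + psi_nu = m, Fdiag is nonsingular and so is R_1.  Convolving  *)
(* with C A'^e = C A^e + sum_d C A^d L C A'^(e-d-1), A' = A + L C, turns      *)
(* R Q = F into S(z) R_1 C(zI-A')^-1 B = F(z).  The condition on L says that  *)
(* the (p, j) block of S(z) is O(z^-(p-j)) below the diagonal, so the rows of *)
(* R_1 C in block i have relative degree i, with a nonsingular coupling       *)
(* matrix K.  For Ty = W R_1, the coupling matrix is then W' K, where W'      *)
(* keeps in each row of W its first nonzero block; a nonzero term of det W'   *)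
(* provides the permutation that makes W block upper triangular.              *)

Require Import Defs.
From mathcomp Require Import all_boot all_order all_algebra.
From mathcomp Require Import reals complex.
From mathcomp Require Import perm zify.

Set Implicit Arguments.
Unset Strict Implicit.
Unset Printing Implicit Defensive.

Import GRing.Theory.
Local Open Scope ring_scope.

(** Read a row of blocks as a power series in 1/z: multiplying it by [Qi] is multiplying by the
    transfer function ([conv_Qi]), and [Emx G i] spans the possible leading coefficients at z^-i
    ([is_lead_coef_Emx]). The choice of the [Fd i] excludes cancellation between blocks, whence
    [psum_psi], [Fdiag_unit] and [R1_unit].

    Since (I - C(zI-A)^-1 L) C(zI-A-LC)^-1 = C(zI-A)^-1, the series S(z), which starts with I, maps
    R_1 C(zI-A-LC)^-1 B to F(z) up to z^-nu ([S_markov]). By the condition on L, S respects the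
    block grading ([S_eq0]), so R_1 C inherits from F the vanishing of early terms ([markov_eq0])
    and the nonsingular leading rows ([leading_markov_unit]).

    For Ty = W R_1, the relative degree of a row is then the first block where that row of W is
    nonzero ([leading_row], [leading_vanish]). Regularity becomes invertibility of the matrix of
    these first blocks, which [unitmx_nonzero_perm] and [bdiag_unitP] relate to P and U. *)

Lemma unitmx_inj (K : fieldType) (m : nat) (M : 'M[K]_m) :
  (forall v : 'rV_m, v *m M = 0 -> v = 0) -> M \in unitmx.
Proof.
move=> injM; rewrite -row_free_unit -kermx_eq0; apply/eqP/row_matrixP=> i.
by rewrite row0; apply: injM; rewrite -row_mul mulmx_ker row0.
Qed.

(** * Block numbers of indices, and diagonal blocks *)

Section Blocks.
Variables (R : realType) (m nu : nat) (ps : nat -> nat).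
Hypothesis psum_m : psum ps 1 nu = m.

Lemma psumS i : (1 <= i)%N -> psum ps 1 i = (psum ps 1 i.-1 + ps i)%N.
Proof. by case: i => // i _; rewrite /psum big_nat_recr. Qed.

Lemma psum_mono i j : (i <= j)%N -> (psum ps 1 i <= psum ps 1 j)%N.
Proof.
elim: j => [|j IHj]; first by case: i.
rewrite leq_eqVlt ltnS => /predU1P[-> //|/IHj le].
by rewrite (leq_trans le) // [X in (_ <= X)%N]psumS // leq_addr.
Qed.

(** Numbered from 1; empty blocks are skipped. Comparing block numbers of indices avoids matrices of
    dependent sizes. *)
Definition blkno (a : 'I_m) : nat :=
  (find (fun i => a < psum ps 1 i.+1)%N (iota 0 nu)).+1.

Lemma blknoP (a : 'I_m) :
  (1 <= blkno a <= nu)%N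
  /\ (psum ps 1 (blkno a).-1 <= a < psum ps 1 (blkno a))%N.
Proof.
rewrite /blkno; set p := fun i => _; set f := find p _.
have nu_gt0 : (0 < nu)%N.
  case: nu psum_m => // m0; have := ltn_ord a.
  by rewrite -[X in (_ < X)%N]m0 /psum big_geq.
have hp : has p (iota 0 nu).
  apply/hasP; exists nu.-1; first by rewrite mem_iota; lia.
  by rewrite /p prednK // psum_m.
have lt_f : (f < nu)%N by move: hp; rewrite has_find size_iota.
split=> //=; apply/andP; split; last first.
  by have := nth_find 0%N hp; rewrite -/f nth_iota.
case f0 : f => [|g]; first by rewrite /psum big_geq.
have := @before_find _ 0%N p (iota 0 nu) g; rewrite -/f f0 => /(_ (leqnn _)).
by rewrite nth_iota ?add0n /p; lia.
Qed.

Lemma blkno_uniq (a : 'I_m) (i : nat) : (1 <= i)%N ->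
  (psum ps 1 i.-1 <= a < psum ps 1 i)%N -> blkno a = i.
Proof.
move=> i1 ai; have [b1 ab] := blknoP a.
case: (ltngtP (blkno a) i) => // lt.
- by have := @psum_mono (blkno a) i.-1; lia.
- by have := @psum_mono i (blkno a).-1; lia.
Qed.

Lemma blkno_pos (a : 'I_m) (i : nat) : blkno a = i ->
  exists p : 'I_(ps i), (a : nat) = (psum ps 1 i.-1 + p)%N.
Proof.
move=> <-; have [b1] := blknoP a.
rewrite [X in (_ < X)%N]psumS; last by lia.
move=> ab; have lt : (a - psum ps 1 (blkno a).-1 < ps (blkno a))%N by lia.
by exists (Ordinal lt); apply/esym/subnKC; case/andP: ab.
Qed.

Lemma blkno_ord (i : nat) (p : 'I_(ps i)) : (1 <= i <= nu)%N ->
  exists2 a : 'I_m, (a : nat) = (psum ps 1 i.-1 + p)%N & blkno a = i.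
Proof.
move=> /andP[i1 inu].
have lt : (psum ps 1 i.-1 + p < psum ps 1 i)%N.
  by rewrite [X in (_ < X)%N]psumS // ltn_add2l.
have ltm : (psum ps 1 i.-1 + p < m)%N.
  by rewrite (leq_trans lt) // -psum_m psum_mono.
exists (Ordinal ltm) => //; apply: blkno_uniq => //=.
by rewrite lt leq_addr.
Qed.

Lemma rowblkE q i (X : 'M[R]_(m, q)) (a : 'I_m) (p : 'I_(ps i)) c :
  (a : nat) = (psum ps 1 i.-1 + p)%N -> rowblk ps i X p c = X a c.
Proof.
move=> ap; rewrite !mxE (bigD1 a) //= !mxE ap eqxx mul1r big1 ?addr0 // => d da.
by rewrite !mxE -ap (inj_eq val_inj) (negPf da) mul0r.
Qed.

Lemma mulPsiE q i (X : 'M[R]_(q, m)) (a : 'I_m) (p : 'I_(ps i)) c :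
  (a : nat) = (psum ps 1 i.-1 + p)%N -> (X *m Psi R m ps i) c p = X c a.
Proof.
move=> ap; rewrite !mxE (bigD1 a) //= !mxE ap eqxx mulr1 big1 ?addr0 // => d da.
by rewrite !mxE -ap (inj_eq val_inj) (negPf da) mulr0.
Qed.

Lemma mulPhiE q i (X : 'M[R]_(m, q)) (a : 'I_m) c : (1 <= i)%N ->
  (i <= blkno a)%N -> Phi R m ps i nu *m X = 0 -> X a c = 0.
Proof.
move=> i1 ia /matrixP X0; have [anu aP] := blknoP a.
have mE : (psum ps 1 i.-1 + psum ps i nu)%N = m.
  by rewrite -psum_m /psum prednK // -big_cat_nat //; lia.
have le := @psum_mono i.-1 (blkno a).-1.
have lt : (a - psum ps 1 i.-1 < psum ps i nu)%N by have := ltn_ord a; lia.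
have := X0 (Ordinal lt) c; rewrite mxE (bigD1 a) //= !mxE /=.
have -> : (psum ps 1 i.-1 + (a - psum ps 1 i.-1))%N = a by lia.
rewrite eqxx mul1r big1 ?addr0 // => d da.
by rewrite !mxE /= subnKC ?(inj_eq val_inj) ?(negPf da) ?mul0r //; lia.
Qed.

Lemma blk_eq0 i k (U : 'M[R]_m) : (1 <= i <= nu)%N -> (1 <= k <= nu)%N ->
  blk ps i k U = 0 <->
  (forall a c, blkno a = i -> blkno c = k -> U a c = 0).
Proof.
move=> hi hk; split=> [/matrixP U0 a c /blkno_pos[p ap] /blkno_pos[q cq]|U0].
  by have := U0 p q; rewrite /blk (mulPsiE _ _ cq) (rowblkE _ _ ap) mxE.
apply/matrixP=> p q; rewrite [RHS]mxE.
have [a ap ai] := blkno_ord p hi; have [c cq ck] := blkno_ord q hk.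
by rewrite /blk (mulPsiE _ _ cq) (rowblkE _ _ ap) U0.
Qed.

Lemma mul_trPsiE q i (X : 'M[R]_(q, ps i)) (a : 'I_m) (p : 'I_(ps i)) c :
  (a : nat) = (psum ps 1 i.-1 + p)%N -> (X *m (Psi R m ps i)^T) c a = X c p.
Proof.
move=> ap; rewrite !mxE (bigD1 p) //= !mxE ap eqxx mulr1 big1 ?addr0 // => d dp.
by rewrite !mxE ap eqn_add2l eq_sym (inj_eq val_inj) (negPf dp) mulr0.
Qed.

Lemma mul_trPsi0 q i (X : 'M[R]_(q, ps i)) (a : 'I_m) c : (1 <= i)%N ->
  blkno a != i -> (X *m (Psi R m ps i)^T) c a = 0.
Proof.
move=> i1 /eqP ai; rewrite !mxE big1 // => d _; rewrite !mxE.
case: eqP => [ad|]; last by rewrite mulr0.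
case: ai; apply: blkno_uniq; rewrite // [X in (_ < X)%N]psumS // ad.
by have := ltn_ord d; lia.
Qed.

(** Kept at size m so that row permutations can act on it. *)
Definition bdiag (U : 'M[R]_m) : 'M[R]_m :=
  \matrix_(a, c) (if blkno a == blkno c then U a c else 0).

(** A left kernel vector of a diagonal block, extended by zero, is one of [bdiag U]; conversely each
    block of a kernel vector of [bdiag U] is killed by the corresponding diagonal block. *)
Lemma bdiag_unitP (U : 'M[R]_m) : bdiag U \in unitmx <->
  (forall i, (1 <= i <= nu)%N -> blk ps i i U \in unitmx).
Proof.
split=> [unitU i hi | unitU].
  apply: unitmx_inj => v vU; set w := v *m (Psi R m ps i)^T.
  suff w0 : w *m bdiag U = 0.
    have {}w0 : w = 0 by rewrite -(mulmxK unitU w) w0 mul0mx.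
    apply/rowP=> p; have [a ap _] := blkno_ord p hi.
    by rewrite -(mul_trPsiE _ _ ap) -/w w0 !mxE.
  apply/rowP=> c; rewrite [RHS]mxE.
  have [ci | ci] := eqVneq (blkno c) i; last first.
    rewrite [LHS]mxE big1 // => a _; have [ai | ai] := eqVneq (blkno a) i.
      by rewrite [bdiag U a c]mxE ai eq_sym (negPf ci) mulr0.
    by rewrite mul_trPsi0 ?mul0r //; lia.
  have [p cp] := blkno_pos ci.
  have := congr1 (fun X : 'rV_(ps i) => X 0 p) vU; rewrite [RHS]mxE => <-.
  rewrite /blk /rowblk !mulmxA -/w (mulPsiE _ _ cp) [LHS]mxE [RHS]mxE.
  apply: eq_bigr => a _; have [ai | ai] := eqVneq (blkno a) i.
    by rewrite [bdiag U a c]mxE ai ci eqxx.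
  by rewrite mul_trPsi0 ?mul0r //; lia.
apply: unitmx_inj => v vU; apply/rowP=> a; rewrite [RHS]mxE.
have [hi _] := blknoP a; set i := blkno a in hi.
have [p ap] := blkno_pos (erefl i).
rewrite -(mulPsiE _ _ ap); set w := v *m _.
suff w0 : w *m blk ps i i U = 0.
  by rewrite -(mulmxK (unitU _ hi) w) w0 mul0mx mxE.
apply/rowP=> q; have [c cq ci] := blkno_ord q hi.
rewrite /blk /rowblk !mulmxA (mulPsiE _ _ cq).
have <- : (v *m bdiag U) 0 c = (0 : 'rV[R]_(ps i)) 0 q by rewrite vU !mxE.
rewrite !mxE; apply: eq_bigr => d _.
have [di | di] := eqVneq (blkno d) i.
  have [p' dp] := blkno_pos di.
  by rewrite [bdiag U d c]mxE ci di eqxx (mul_trPsiE _ _ dp) (mulPsiE _ _ dp).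
by rewrite mul_trPsi0 ?mul0r ?[bdiag U d c]mxE ?ci ?(negPf di) ?mulr0 //; lia.
Qed.

End Blocks.

(** * Rows with prescribed orders and independent leading coefficients *)

Section Leading.
Variables (R : realType) (m : nat) (b : 'I_m -> nat) (M : nat -> 'M[R]_m).
Hypothesis M0 : forall a k, (1 <= k < b a)%N -> row a (M k) = 0.

Definition leading_mx : 'M[R]_m := \matrix_a row a (M (b a)).

(** Indices with [b c > j] drop out by [M0], those with [b c < j] by the assumption on u; the
    remaining rows of [M j] are rows of [leading_mx]. *)
Lemma leading_row (u : 'rV[R]_m) (j : nat) : (1 <= j)%N ->
  (forall c, (b c < j)%N -> u 0 c = 0) ->
  u *m M j = (\row_c (if b c == j then u 0 c else 0)) *m leading_mx.
Proof.
move=> j1 u0; apply/rowP=> d; rewrite !mxE; apply: eq_bigr => c _.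
rewrite !mxE; have [lt | gt | ->] := ltngtP (b c) j; rewrite ?mul0r //.
  by rewrite u0 // mul0r.
have /rowP/(_ d) : row c (M j) = 0 by apply: M0; rewrite j1.
by rewrite !mxE => ->; rewrite mulr0.
Qed.

Lemma leading_vanish (u : 'rV[R]_m) (r : nat) : leading_mx \in unitmx ->
  (forall c, 1 <= b c)%N ->
  (forall k, (1 <= k < r)%N -> u *m M k = 0) ->
  forall c, (b c < r)%N -> u 0 c = 0.
Proof.
move=> unitK b1 uM0 c; have [j] := ubnP (b c); elim: j c => // j IHj c.
rewrite ltnS => bj br; have := uM0 (b c); rewrite b1 br => /(_ isT).
rewrite leading_row ?b1 //; last by move=> d db; apply: IHj; lia.
move=> /(congr1 (mulmx^~ (invmx leading_mx))); rewrite mulmxK // mul0mx.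
by move=> /rowP/(_ c); rewrite !mxE eqxx.
Qed.

End Leading.

(** * Power series, echelon form and output feedback *)

Section Convolution.
Variables (R : realType) (n m : nat).
Variables (A : 'M[R]_n) (B : 'M[R]_(n, m)) (C : 'M[R]_(m, n)).

(** Coefficient of z^-(k+1) in g(z) C(zI-A)^-1 B, with g(z) the sum of the g_i z^-i. *)
Definition conv p (g : nat -> 'M[R]_(p, m)) (k : nat) : 'M[R]_(p, m) :=
  \sum_(i < k.+1) g i *m (C *m A ^+ (k - i) *m B).

Lemma colblkE p nu (X : 'M[R]_(p, \sum_(k < nu) m)) (k : 'I_nu) :
  colblk X k.+1 = submxrow X k.
Proof.
rewrite /colblk; case: pickP => [c /eqP[ck]|/(_ k)]; last by rewrite eqxx.
by congr submxrow; apply: val_inj.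
Qed.

Lemma mul_colblk p q nu (X : 'M[R]_(p, q)) (Y : 'M[R]_(q, \sum_(k < nu) m)) k :
  colblk (X *m Y) k = X *m colblk Y k.
Proof.
by rewrite /colblk; case: pickP => *; rewrite ?mulmx0 // mul_submxrow.
Qed.

(** The double subtraction gives the block the form [g (nu - j.+1)] expected by [conv_Qi]. *)
Lemma mxrow_colblk p nu (X : 'M[R]_(p, \sum_(k < nu) m)) :
  X = \mxrow_(j < nu) colblk X (nu - (nu - j.+1)).
Proof.
rewrite -[LHS]submxrowK; apply/eq_mxrowP => j.
by rewrite subKn // colblkE.
Qed.

Lemma sum_ord_trunc (V : zmodType) (nu i : nat) (f : nat -> V) : (i < nu)%N ->
  (forall j, (i < j)%N -> f j = 0) ->
  \sum_(j < nu) f j = \sum_(j < i.+1) f j.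
Proof.
move=> inu f0; rewrite (big_ord_widen _ f inu) [RHS]big_mkcond.
by apply: eq_bigr => j _; case: ltnP => // /f0.
Qed.

(** Reversing its row blocks turns [Qi] into an upper triangular block Toeplitz matrix. *)
Lemma conv_Qi p nu (g : nat -> 'M[R]_(p, m)) (k : nat) : (k < nu)%N ->
  colblk ((\mxrow_(j < nu) g (nu - j.+1)%N) *m Qi A B C nu) k.+1 = conv g k.
Proof.
move=> knu; rewrite -[k]/(nat_of_ord (Ordinal knu)) colblkE.
rewrite mul_mxrow_mxblock mxrowK /= (reindex_inj rev_ord_inj) /=.
pose f i := g i *m (if (k < i)%N then 0 else C *m A ^+ (k - i) *m B).
transitivity (\sum_(i < nu) f i).
  apply: eq_bigr => i _; have lt := ltn_ord i.
  rewrite /f; congr (g _ *m _); first by lia.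
  have -> : ((nu - i.+1).+1 + k.+1 <= nu)%N = (k < i)%N by lia.
  by case: ltnP => // ik; congr (_ *m _ ^+ _ *m _); lia.
rewrite (sum_ord_trunc knu) => [|j kj]; last by rewrite /f kj mulmx0.
by apply: eq_bigr => i _; rewrite /f ltnNge -ltnS ltn_ord.
Qed.

Lemma colblk_conv p nu (X : 'M[R]_(p, \sum_(k < nu) m)) (k : nat) :
  (k < nu)%N ->
  colblk (X *m Qi A B C nu) k.+1 = conv (fun i => colblk X (nu - i)) k.
Proof.
move=> knu; rewrite [in LHS](mxrow_colblk X).
exact: (conv_Qi (fun i => colblk X (nu - i)) knu).
Qed.

(* x is the coefficient of z^-(i+1) in some g(z) C(zI-A)^-1 B whose lower      *)
(* terms vanish; conv is the coefficient numbered from 0.                      *)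
Definition is_lead_coef (i : nat) (x : 'rV[R]_m) : Prop :=
  exists g : nat -> 'rV[R]_m, (forall k, (k < i)%N -> conv g k = 0)
                              /\ conv g i = x.

Lemma conv_shift p (g : nat -> 'M[R]_(p, m)) k :
  g 0%N = 0 -> conv g k.+1 = conv (fun i => g i.+1) k.
Proof. by move=> g0; rewrite /conv big_ord_recl g0 mul0mx add0r. Qed.

Lemma is_lead_coefS i x : is_lead_coef i x -> is_lead_coef i.+1 x.
Proof.
move=> [g [g0 gi]]; exists (fun k => if k is k'.+1 then g k' else 0).
split=> [[_|k ki] |]; last by rewrite conv_shift.
  by rewrite /conv big_ord1 mul0mx.
by rewrite conv_shift // g0.
Qed.

Lemma pivot_exists p q (G : 'M[R]_(p, q)) r :
  row r G = 0 \/ exists c, is_pivot G r c.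
Proof.
have [/existsP[c Gc]|] := boolP [exists c, G r c != 0]; last first.
  rewrite negb_exists => /forallP G0; left; apply/rowP=> c.
  by rewrite !mxE; apply/eqP; move: (G0 c); rewrite negbK.
right; pose val_ord (j : 'I_q) : nat := j.
case: (@arg_minnP _ c (fun c => G r c != 0) val_ord Gc) => c' Gc' minc.
exists c'; rewrite /is_pivot Gc'; apply/forallP=> j; apply/implyP=> jc.
by apply: contraLR jc => /minc; rewrite -leqNgt.
Qed.

Lemma pivot_colblk0 p nu (G : 'M[R]_(p, \sum_(k < nu) m)) r c (k : 'I_nu) :
  is_pivot G r c -> (k < tagnat.sig1 c)%N -> row r (submxrow G k) = 0.
Proof.
move=> /andP[_ /forallP G0] kc; apply/rowP=> q; rewrite !mxE.
apply/eqP; apply: (implyP (G0 _)); rewrite ltnNge; apply/negP=> cq.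
have := @tagnat.le_sig1 nu (fun=> m) c (tagnat.Rank k q) cq.
by rewrite tagnat.Rank1K leEord leqNgt kc.
Qed.

Lemma EmxE p nu (G : 'M[R]_(p, \sum_(k < nu) m)) i :
  Emx G i = rowsub (fun a => enum_val a) 1%:M *m colblk G i.
Proof. by rewrite /Emx rowsubE. Qed.

Lemma is_lead_coef_Emx nu (G : 'M[R]_(\sum_(j < nu) m, \sum_(k < nu) m)) i x :
  is_rref_of (Qi A B C nu) G -> (i < nu)%N ->
  is_lead_coef i x <-> (x <= Emx G i.+1)%MS.
Proof.
move=> [[_ _ G1 G0] [V unitV GV]] inu; split.
  move=> [g [g0 gi]]; set r := \mxrow_(j < nu) g (nu - j.+1)%N.
  pose t := r *m invmx V.
  have rQ : r *m Qi A B C nu = t *m G by rewrite GV mulmxA mulmxKV.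
  (* A pivot column of G has a single nonzero entry, so tG reads off t there; t thus vanishes on
     rows with earlier pivots, and rows with later pivots are zero in this block. *)
  have t0 q c : is_pivot G q c -> (tagnat.sig1 c < i)%N -> t 0 q = 0.
    move=> qc ci; have tc : (t *m G) 0 c = t 0 q.
      rewrite mxE (bigD1 q) //= (G1 _ _ qc) mulr1 [X in _ + X]big1 ?addr0 //.
      move=> d dq.
      by rewrite (G0 _ _ _ qc dq) mulr0.
    have := conv_Qi g (ltn_ord (tagnat.sig1 c)).
    rewrite -/r rQ g0 // colblkE => /matrixP/(_ 0 (tagnat.sig2 c)).
    by rewrite mxE [RHS]mxE tagnat.sig2K tc.
  rewrite -gi -(conv_Qi g inu) -/r rQ mul_colblk mulmx_sum_row.
  apply: summx_sub => q _; have [qi|qi] := boolP (q \in pivot_rows G i.+1).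
    rewrite scalemx_sub // -(enum_rankK_in qi qi).
    by rewrite -(row_rowsub (fun a => enum_val a)) row_sub.
  have -> : colblk G i.+1 = submxrow G (Ordinal inu) by rewrite -colblkE.
  have [q0|[c qc]] := pivot_exists G q.
    rewrite [row _ _](_ : _ = 0) ?scaler0 ?sub0mx //.
    apply/rowP=> d; move/rowP: q0 => /(_ (tagnat.Rank (Ordinal inu) d)).
    by rewrite !mxE.
  have [lt|gt|ci] := ltngtP (tagnat.sig1 c) i.
  - by rewrite (t0 _ _ qc lt) scale0r sub0mx.
  - by rewrite (@pivot_colblk0 _ _ G q c (Ordinal inu) qc gt) scaler0 sub0mx.
  - case/negP: qi; rewrite inE; apply/existsP; exists c.
    by rewrite qc /= ci.
case/submxP=> u ->; rewrite EmxE mulmxA; set t := u *m _.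
have tG : t *m G = t *m V *m Qi A B C nu by rewrite GV mulmxA.
exists (fun j => colblk (t *m V) (nu - j)); split=> [k ki|]; last first.
  by rewrite -colblk_conv // -tG mul_colblk.
have knu : (k < nu)%N by rewrite (ltn_trans ki).
rewrite -colblk_conv // -tG mul_colblk /t -mulmxA -rowsubE.
rewrite [rowsub _ _](_ : _ = 0) ?mulmx0 //; apply/row_matrixP=> a.
rewrite row_rowsub row0; have := enum_valP a; rewrite inE.
case/existsP=> c /andP[ac /eqP[ci]].
rewrite -[k]/(nat_of_ord (Ordinal knu)) colblkE (pivot_colblk0 ac) //=.
by rewrite ci.
Qed.

(** Multiplication by 1/z delays a leading coefficient by one step. *)
Lemma Emx_mono nu (G : 'M[R]_(\sum_(j < nu) m, \sum_(k < nu) m)) i :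
  is_rref_of (Qi A B C nu) G -> (i < nu)%N -> (Emx G i <= Emx G i.+1)%MS.
Proof.
move=> HG inu; apply/rV_subP => x; case: i inu => [|i] inu.
  move=> x0; suff -> : x = 0 by rewrite sub0mx.
  apply/eqP; rewrite -submx0 (submx_trans x0) // EmxE.
  apply/row_subP => a; have := enum_valP a; rewrite inE.
  by case/existsP=> c /andP[_].
move/(is_lead_coef_Emx _ HG (ltnW inu))/is_lead_coefS.
by move/(is_lead_coef_Emx _ HG inu).
Qed.

Variable L : 'M[R]_(n, m).

Definition Omega_coef (d : nat) : 'M[R]_m :=
  if d is d'.+1 then - (C *m A ^+ d' *m L) else 1%:M.

Lemma colblk_Omega p nu (X : 'M[R]_(p, \sum_(k < nu) m)) i : (i < nu)%N ->
  colblk (X *m Omega_o A C L nu) (nu - i)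
    = \sum_(j < i.+1) colblk X (nu - j) *m Omega_coef (i - j).
Proof.
move=> inu; pose k := rev_ord (Ordinal inu).
have -> : (nu - i = k.+1)%N by rewrite /=; lia.
rewrite colblkE [in LHS](mxrow_colblk X) mul_mxrow_mxblock mxrowK.
rewrite (reindex_inj rev_ord_inj) /=.
pose f j := colblk X (nu - j) *m
  (if (i < j)%N then 0 else Omega_coef (i - j)).
transitivity (\sum_(j < nu) f j).
  apply: eq_bigr => j _; have lt := ltn_ord j.
  rewrite /f; congr (colblk X _ *m _); first by lia.
  rewrite (inj_eq rev_ord_inj) -val_eqE /=.
  case: (ltngtP j i) => ji.
  - have -> : (nu - i.+1 < nu - j.+1)%N by lia.
    have -> : (i - j = (i - j.+1).+1)%N by lia.
    by rewrite /=; congr (- (_ *m _ ^+ _ *m _)); lia.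
  - by rewrite ltnNge (_ : (nu - j.+1 <= nu - i.+1)%N) //; lia.
  - by rewrite ji subnn.
rewrite (sum_ord_trunc inu) => [|j kj]; last by rewrite /f kj mulmx0.
by apply: eq_bigr => j _; rewrite /f ltnNge -ltnS ltn_ord.
Qed.

(** Expand the power and sort the words by the position of their leftmost D. *)
Lemma pow_feedback (D : 'M[R]_n) e :
  (A + D) ^+ e = A ^+ e + \sum_(d < e) A ^+ d *m D *m (A + D) ^+ (e - d.+1).
Proof.
elim: e => [|e IHe]; first by rewrite big_ord0 addr0.
rewrite exprS {1}IHe big_ord_recl /= expr0 mul1mx subSS subn0.
rewrite [X in _ = X](_ : _ = A *m (A ^+ e +
   \sum_(d < e) A ^+ d *m D *m (A + D) ^+ (e - d.+1)) + D *m (A + D) ^+ e).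
  by rewrite -IHe mulrDl.
rewrite mulmxDr [A ^+ e.+1]exprS -addrA [_ *m _ ^+ e + _]addrC.
congr (_ + (_ + _)).
by rewrite mulmx_sumr; apply: eq_bigr => d _; rewrite exprS !mulmxA.
Qed.

Lemma Omega_feedback e :
  \sum_(d < e.+1) Omega_coef d *m (C *m (A + L *m C) ^+ (e - d)) = C *m A ^+ e.
Proof.
rewrite big_ord_recl mul1mx subn0 {1}pow_feedback mulmxDr -addrA mulmx_sumr.
rewrite -big_split big1 ?addr0 // => d _ /=.
by rewrite mulNmx !mulmxA subrr.
Qed.

Lemma sum_triangle (V : nmodType) (f : nat -> nat -> V) k :
  \sum_(i < k.+1) \sum_(j < i.+1) f i j =
  \sum_(j < k.+1) \sum_(d < (k - j).+1) f (d + j)%N j.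
Proof.
transitivity (\sum_(i < k.+1) \sum_(j < k.+1 | (j <= i)%N) f i j).
  by apply: eq_bigr => i _; rewrite (big_ord_widen _ (f i) (ltn_ord i)).
rewrite (exchange_big_dep xpredT) //=; apply: eq_bigr => j _.
transitivity (\sum_(j <= i < k.+1) f i j).
  rewrite -(big_mkord (fun i => j <= i)%N (fun i => f i j)).
  by rewrite [RHS](big_nat_widenl j 0).
by rewrite -{1}[nat_of_ord j]add0n big_addn subSn -1?ltnS // big_mkord.
Qed.

Lemma conv_feedback p (g : nat -> 'M[R]_(p, m)) k :
  \sum_(i < k.+1) (\sum_(j < i.+1) g j *m Omega_coef (i - j))
                  *m (C *m (A + L *m C) ^+ (k - i) *m B) = conv g k.
Proof.
under eq_bigr do rewrite mulmx_suml.
rewrite (sum_triangle (fun i j => g j *m Omega_coef (i - j)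
                  *m (C *m (A + L *m C) ^+ (k - i) *m B))).
apply: eq_bigr => j _; rewrite -Omega_feedback mulmx_suml mulmx_sumr.
by apply: eq_bigr => d _; rewrite addnK addnC subnDA !mulmxA.
Qed.

End Convolution.

(** * Consequences of the choice of F and R and of the condition on L *)

Section AdmissibleChoice.
Variables (R : realType) (n m : nat).
Variables (A : 'M[R]_n) (B : 'M[R]_(n, m)) (C : 'M[R]_(m, n)) (nu : nat).
Hypothesis phi_nu : phi A B C nu = m.
Variable G : 'M[R]_(\sum_(j < nu) m, \sum_(k < nu) m).
Hypothesis HG : is_rref_of (Qi A B C nu) G.
Variable Fd : forall i : nat, 'M[R]_(psi A B C i, m).
Variables F Rm : 'M[R]_(m, \sum_(k < nu) m).
Hypothesis HFd : admissible_Fi G Fd.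
Hypothesis HFR : admissible_FR Fd F Rm.

Let ps := psi A B C.

Lemma Fd_sub_Emx i : (1 <= i <= nu)%N -> (Fd i <= Emx G i)%MS.
Proof.
move=> hi; apply/rV_subP => v vF; have [-> | v0] := eqVneq v 0.
  exact: sub0mx.
by have [_ /(_ v vF v0)[]] := HFd hi.
Qed.

Lemma Fd_Emx_eq0 i (v : 'rV[R]_m) : (1 <= i <= nu)%N ->
  (v <= Fd i)%MS -> (v <= Emx G i.-1)%MS -> v = 0.
Proof.
move=> hi vF vE; apply/eqP; apply: contraTT vE => v0.
by have [_ /(_ v vF v0)[]] := HFd hi.
Qed.

(** The sum is direct: its first j terms lie in [Emx G j], which [Fd j.+1] meets only in 0. *)
Lemma sum_Fd j : (j <= nu)%N ->
  \rank (\sum_(1 <= i < j.+1) <<Fd i>>)%MS = psum ps 1 j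
  /\ (\sum_(1 <= i < j.+1) <<Fd i>> <= Emx G j)%MS.
Proof.
elim: j => [|j IHj] jnu.
  by rewrite /psum !big_geq // mxrank0 sub0mx.
have [rk sub] := IHj (ltnW jnu).
have hj : (1 <= j.+1 <= nu)%N by [].
rewrite big_nat_recr //=; split; last first.
  rewrite addsmx_sub genmxE Fd_sub_Emx // andbT.
  exact: submx_trans sub (Emx_mono HG jnu).
rewrite mxrank_disjoint_sum.
  by rewrite rk genmxE (HFd hj).1 [RHS]psumS.
apply/eqP/rowV0P => v; rewrite sub_capmx genmxE => /andP[vS vF].
by apply: (Fd_Emx_eq0 hj vF); apply: submx_trans sub.
Qed.

(* The truncated subtractions in psi give only the inequality >=; the other    *)
(* one comes from the independence of the row spaces of the F_i.               *)
Lemma psum_psi : psum ps 1 nu = m.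
Proof.
apply/eqP; rewrite eqn_leq; apply/andP; split.
  by rewrite -(sum_Fd (leqnn nu)).1 rank_leq_col.
rewrite -[X in (X <= _)%N]phi_nu.
suff le k : (phi A B C k <= psum ps 1 k)%N by apply: le.
elim: k => [|k IHk]; first by rewrite /phi subnn.
rewrite [X in (_ <= X)%N]psumS //= /ps /psi /= -leq_subLR.
by rewrite leq_sub2l.
Qed.

Notation bn := (blkno nu ps).

Lemma row_Fd i (p : 'I_(ps i)) (a : 'I_m) :
  (1 <= i <= nu)%N -> (a : nat) = (psum ps 1 i.-1 + p)%N ->
  row p (Fd i) = row a (colblk F i).
Proof.
have [Fi _ _] := HFR; move=> hi ap; rewrite -Fi //.
by apply/rowP=> c; rewrite [LHS]mxE [RHS]mxE (rowblkE _ _ ap).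
Qed.

Lemma colblk_F0 i (a : 'I_m) c : (1 <= i < bn a)%N -> colblk F i a c = 0.
Proof.
have [_ F0 _] := HFR; move=> hi; have [ba _] := blknoP psum_psi a.
have [p ap] := blkno_pos psum_psi (erefl (bn a)).
have {}F0 : rowblk ps (bn a) (colblk F i) = 0 by apply: F0; lia.
by rewrite -(rowblkE _ _ ap) F0 mxE.
Qed.

Definition Fdiag : 'M[R]_m := \matrix_a row a (colblk F (bn a)).

Lemma Fdiag_unit : Fdiag \in unitmx.
Proof.
rewrite -row_full_unit /row_full eqn_leq rank_leq_col /=.
rewrite -[X in (X <= _)%N]psum_psi -(sum_Fd (leqnn nu)).1 mxrankS //.
rewrite big_nat_cond; apply: (big_ind (fun X : 'M_m => X <= Fdiag)%MS).
- exact: sub0mx.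
- by move=> X Y XF YF; rewrite addsmx_sub XF.
move=> i; rewrite andbT ltnS => hi; rewrite genmxE; apply/row_subP => p.
have [a ap ai] := blkno_ord psum_psi p hi.
rewrite (row_Fd hi ap) (_ : row a _ = row a Fdiag) ?row_sub //.
by rewrite rowK ai.
Qed.

Let R1 := rev_colblk Rm 1.

Lemma conv_Rm k : (k < nu)%N ->
  conv A B C (fun i => colblk Rm (nu - i)) k = colblk F k.+1.
Proof. by move=> knu; rewrite -colblk_conv //; have [_ _ ->] := HFR. Qed.

(** If v R_1 = 0, the series vR has no constant term, so its leading coefficient also occurs one
    step earlier. In the first nonzero block i of v it would lie in both [Fd i] and [Emx G i.-1],
    hence vanish, although [Fd i] has full row rank. *)
Lemma R1_unit : R1 \in unitmx.
Proof.
apply: unitmx_inj => v vR1; pose g i := v *m colblk Rm (nu - i).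
have gF k : (k < nu)%N -> conv A B C g k = v *m colblk F k.+1.
  move=> knu; rewrite -conv_Rm // mulmx_sumr.
  by apply: eq_bigr => i _; rewrite !mulmxA.
have g0 : g 0%N = 0 by rewrite /g -vR1 /R1 /rev_colblk addnK subn0.
suff v0 a : v 0 a = 0 by apply/rowP=> a; rewrite v0 mxE.
have [j] := ubnP (bn a); elim: j a => // j IHj a; rewrite ltnS => baj.
have {}IHj c : (bn c < bn a)%N -> v 0 c = 0 by move=> ?; apply: IHj; lia.
have [hi _] := blknoP psum_psi a; set i := bn a in hi baj IHj.
have [p ap] := blkno_pos psum_psi (erefl i).
have vF0 k : (1 <= k < i)%N -> v *m colblk F k = 0.
  move=> hk; apply/rowP=> d; rewrite mxE [RHS]mxE big1 // => c _.
  have [ci | ci] := ltnP (bn c) i; first by rewrite IHj // mul0r.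
  by rewrite colblk_F0 ?mulr0 //; lia.
pose w := v *m Psi R m ps i.
have wF : w *m Fd i = v *m colblk F i.
  have [Fi _ _] := HFR; rewrite -Fi // /rowblk mulmxA.
  apply/rowP=> d; rewrite mxE [RHS]mxE; apply: eq_bigr => c _.
  have [ci | ci | ci] := ltngtP (bn c) i.
  - by rewrite IHj // (mul_trPsi0 psum_psi) ?mul0r //; lia.
  - by rewrite colblk_F0 ?mulr0 //; lia.
  - have [q cq] := blkno_pos psum_psi ci.
    by rewrite (mul_trPsiE _ _ cq) (mulPsiE _ _ cq).
have wF0 : w *m Fd i = 0.
  apply: (Fd_Emx_eq0 hi); first exact: submxMl.
  rewrite wF; case: i hi vF0 {IHj baj p ap w wF} => [|[|i]] // hi vF0.
    by rewrite -gF // /conv big_ord1 g0 mul0mx sub0mx.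
  apply/(is_lead_coef_Emx _ HG); first by lia.
  exists (fun k => g k.+1); split=> [k ki|]; rewrite -conv_shift // gF //;
    last by lia.
  by rewrite vF0 //; lia.
have w0 : w = 0.
  apply/eqP; rewrite -(mulmx_free_eq0 _ (B := Fd i)) ?wF0 //.
  by rewrite /row_free (HFd hi).1.
by rewrite -(mulPsiE v 0 ap) -/w w0 mxE.
Qed.

Variable L : 'M[R]_(n, m).
Hypothesis HL : forall i j : nat,
  (2 <= i <= nu - 1)%N -> (1 <= j <= nu - i)%N ->
  Phi R m ps (i + j) nu *m rev_colblk (Smx A C Rm L) i *m Psi R m ps j = 0.

Let S i := rev_colblk (Smx A C Rm L) i.

Lemma SmxE i : (i < nu)%N ->
  S i.+1 = (\sum_(j < i.+1) colblk Rm (nu - j) *m Omega_coef A C L (i - j))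
           *m invmx R1.
Proof.
move=> inu; rewrite -colblk_Omega // /S /rev_colblk addn1 subSS /Smx.
pose k := rev_ord (Ordinal inu); have -> : (nu - i = k.+1)%N by rewrite /=; lia.
set X := Rm *m _; rewrite !colblkE -[in LHS](submxrowK X) mul_mxrow_mxdiag.
by rewrite mxrowK.
Qed.

Lemma S1 : (0 < nu)%N -> S 1 = 1%:M.
Proof.
move=> nu0; rewrite SmxE // big_ord1 subnn mulmx1 subn0.
by rewrite -[X in colblk _ X](addnK 1%N) mulmxV ?R1_unit.
Qed.

Lemma S_eq0 i a c : (2 <= i)%N -> (i + bn c <= bn a)%N -> S i a c = 0.
Proof.
move=> i2 ica; have [ha _] := blknoP psum_psi a.
have [hc _] := blknoP psum_psi c.
have [q cq] := blkno_pos psum_psi (erefl (bn c)).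
rewrite -(mulPsiE _ _ cq); apply: (mulPhiE psum_psi _ _ ica); first by lia.
by rewrite mulmxA; apply: HL; lia.
Qed.

(** Numbered from 1: the coefficient of z^-k in R_1 C(zI-A-LC)^-1 B. *)
Definition markov (k : nat) : 'M[R]_m :=
  R1 *m (C *m (A + L *m C) ^+ k.-1 *m B).

Lemma S_markov k : (k < nu)%N ->
  \sum_(i < k.+1) S i.+1 *m markov (k - i).+1 = colblk F k.+1.
Proof.
move=> knu; rewrite -conv_Rm // -(conv_feedback _ _ _ L).
apply: eq_bigr => i _; rewrite SmxE; last by have := ltn_ord i; lia.
by rewrite /markov mulmxA mulmxKV ?R1_unit.
Qed.

Lemma markov_eq0 a k : (1 <= k < bn a)%N -> row a (markov k) = 0.
Proof.
have [ha _] := blknoP psum_psi a.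
case: k => // k; have [j] := ubnP k; elim: j a k ha => // j IHj a k ha kj ka.
have knu : (k < nu)%N by lia.
apply/rowP=> d; have := congr1 (fun X : 'M_m => X a d) (S_markov knu).
rewrite big_ord_recl S1 ?mul1mx ?subn0; last by lia.
rewrite colblk_F0 // [LHS]mxE summxE [X in _ + X]big1 ?addr0; last first.
  move=> i _; rewrite mxE big1 // => c _; have lt := ltn_ord i.
  have [hc _] := blknoP psum_psi c; rewrite lift0.
  (* Either c lies in a late block and the induction hypothesis applies, or the grading kills the
     entry of S. *)
  have [ci | ci] := ltnP (k - i.+1).+1 (bn c); last first.
    by rewrite S_eq0 ?mul0r //; lia.
  have kj' : (k - i.+1 < j)%N by lia.
  have /rowP/(_ d) := IHj c _ hc kj' ci.
  by rewrite !mxE => ->; rewrite mulr0.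
by move=> Mad; rewrite mxE Mad mxE.
Qed.

(** In [S_markov] at k + 1 = [bn a], row a of F is the leading row of [markov] plus terms that the
    grading of S keeps in the span of leading rows. So this span contains the rows of [Fdiag]. *)
Lemma leading_markov_unit : leading_mx bn markov \in unitmx.
Proof.
suff le : (Fdiag <= leading_mx bn markov)%MS.
  rewrite -row_full_unit /row_full eqn_leq rank_leq_col /=.
  by rewrite -[X in (X <= _)%N](mxrank_unit Fdiag_unit) mxrankS.
apply/row_subP => a; rewrite rowK.
have [ha _] := blknoP psum_psi a.
have [k bk] : {k | bn a = k.+1} by exists (bn a).-1; lia.
have knu : (k < nu)%N by lia.
rewrite bk -S_markov // big_ord_recl S1 ?mul1mx ?subn0; last by lia.
rewrite linearD /= -bk addmx_sub //.
  by rewrite (_ : row a _ = row a (leading_mx bn markov)) ?row_sub ?rowK.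
rewrite linear_sum summx_sub // => i _; rewrite /= /bump leq0n add1n row_mul.
rewrite (leading_row markov_eq0) // ?submxMl // => c ci.
by rewrite mxE S_eq0 //; have := ltn_ord i; lia.
Qed.

End AdmissibleChoice.

(** * The permutation, and the equivalence *)

Lemma unitmx_nonzero_perm (K : fieldType) (m : nat) (M : 'M[K]_m) :
  M \in unitmx ->
  exists s : 'S_m, forall i, M i (s i) != 0.
Proof.
rewrite unitmxE unitfE => detM.
have [s sP|no] := pickP (fun s : 'S_m => [forall i, M i (s i) != 0]).
  by exists s; apply/forallP.
case/negP: detM; rewrite /determinant big1 // => s _.
have [i Mi] : exists i, M i (s i) == 0.
  apply/existsP; apply: contraFT (no s); rewrite negb_exists => /forallP Ms.
  exact/forallP.
by rewrite (bigD1 i) //= (eqP Mi) mul0r mulr0.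
Qed.

Lemma unitmx_row_neq0 (K : fieldType) (m : nat) (M : 'M[K]_m) i :
  M \in unitmx -> row i M != 0.
Proof.
move=> uM; apply/eqP=> Mi0; have := congr1 (row i) (mulmxV uM).
rewrite row_mul Mi0 mul0mx => /rowP/(_ i)/eqP.
by rewrite !mxE eqxx eq_sym oner_eq0.
Qed.

Theorem theorem3 (R : realType) (n m : nat)
    (A : 'M[R]_n) (B : 'M[R]_(n, m)) (C : 'M[R]_(m, n)) (nu : nat)
    (Hinv : invertible A B C)
    (Hnu : is_nistar A B C nu) (Hnu3 : (3 <= nu)%N)
    (G : 'M[R]_(\sum_(j < nu) m, \sum_(k < nu) m))
    (HG : is_rref_of (Qi A B C nu) G)
    (Fd : forall i : nat, 'M[R]_(psi A B C i, m))
    (F Rm : 'M[R]_(m, \sum_(k < nu) m))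
    (HFd : admissible_Fi G Fd)
    (HFR : admissible_FR Fd F Rm)
    (L : 'M[R]_(n, m))
    (HL : forall i j : nat, (2 <= i <= nu - 1)%N -> (1 <= j <= nu - i)%N ->
       Phi R m (psi A B C) (i + j) nu *m rev_colblk (Smx A C Rm L) i
         *m Psi R m (psi A B C) j = 0)
    (Ty : 'M[R]_m) (HTy : Ty \in unitmx) :
  has_regular_relative_degree (A + L *m C) B (Ty *m C) <->
  exists P U : 'M[R]_m,
    [/\ is_perm_mx P, is_block_upper (psi A B C) nu U
      & Ty = P *m U *m rev_colblk Rm 1].
Proof.
have [/andP[_ nun] phi_nu _] := Hnu.
have psum_m := psum_psi phi_nu HG HFd.
have uR1 := R1_unit phi_nu HG HFd HFR.
have M0 := markov_eq0 phi_nu HG HFd HFR HL.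
have uK := leading_markov_unit phi_nu HG HFd HFR HL.
set M := markov A B C Rm L in M0 uK; set b := blkno nu (psi A B C) in M0 uK.
set R1 := rev_colblk Rm 1 in uR1 *; set K := leading_mx b M in uK.
have bP a : (1 <= b a <= nu)%N by have [] := blknoP psum_m a.
have [W TyW] : exists W, Ty = W *m R1.
  by exists (Ty *m invmx R1); rewrite mulmxKV.
have rowW a k :
    row a (Ty *m C) *m (A + L *m C) ^+ k *m B = row a W *m M k.+1.
  by rewrite TyW -!row_mul /M /markov !mulmxA.
have coupE r : (forall a, 1 <= r a)%N ->
    (forall a c, (b c < r a)%N -> W a c = 0) ->
    coupling_mx (A + L *m C) B (Ty *m C) r =
      (\matrix_(a, c) (if b c == r a then W a c else 0)) *m K.
  move=> r1 W0; apply/row_matrixP=> a; rewrite rowK rowW prednK // row_mul.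
  rewrite (leading_row M0) // => [|c /W0]; last by rewrite mxE.
  by congr (_ *m _); apply/rowP=> c; rewrite !mxE.
split=> [[r [rd]]|[P [U [/is_perm_mxP[s ->] [U0 uU] TyE]]]].
  have r1 a : (1 <= r a)%N by have [/andP[]] := rd a.
  have W0 a c : (b c < r a)%N -> W a c = 0.
    have [_ rd0 _] := rd a; move=> bc.
    have := leading_vanish (u := row a W) M0 uK _ _ bc; rewrite mxE; apply.
      by move=> d; case/andP: (bP d).
    by case=> // k kr; rewrite -rowW rd0 //; lia.
  rewrite (coupE _ r1 W0); set Wd := \matrix_(_, _) _.
  (* A nonzero entry of [Wd] at (a, s a) forces [b (s a) = r a], so s^-1 sorts the rows of W by
     block. *)
  rewrite unitmx_mul => /andP[uWd _]; have [s sP] := unitmx_nonzero_perm uWd.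
  have bs a : b (s a) = r a.
    by apply/eqP; move: (sP a); rewrite mxE; case: ifP; rewrite ?eqxx.
  have rs a : r ((s^-1)%g a) = b a by rewrite -bs permKV.
  exists (perm_mx s), (row_perm s^-1 W); split.
  - exact: perm_mx_is_perm.
  - split=> [i k ki inu | i hi].
      apply/(blk_eq0 psum_m); [lia | lia |] => a c ai ck.
      by rewrite mxE W0 // rs /b ai ck; lia.
    move: i hi; apply/(bdiag_unitP psum_m).
    rewrite [bdiag _ _ _](_ : _ = row_perm s^-1 Wd).
      by rewrite row_permE unitmx_mul unitmx_perm.
    by apply/matrixP=> a c; rewrite !mxE rs eq_sym.
  - by rewrite row_permE mulmxA -perm_mxM mulgV perm_mx1 mul1mx.
have WE : W = row_perm s U.
  by rewrite row_permE -(mulmxK uR1 W) -TyW TyE mulmxK.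
have W0 a c : (b c < b (s a))%N -> W a c = 0.
  move=> lt; rewrite WE mxE; have hc := bP c; have hs := bP (s a).
  have lt' : (1 <= b c < b (s a))%N by lia.
  have sn : (b (s a) <= nu)%N by lia.
  exact: (blk_eq0 psum_m U hs hc).1 (U0 _ _ lt' sn) _ _ erefl erefl.
have s1 a : (1 <= b (s a))%N by case/andP: (bP (s a)).
(* The relative degree of row a is the block number of the row of U that P moves there. *)
have uC : coupling_mx (A + L *m C) B (Ty *m C) (fun a => b (s a)) \in unitmx.
  rewrite coupE // unitmx_mul uK andbT.
  rewrite [\matrix_(_, _) _](_ : _ = row_perm s (bdiag nu (psi A B C) U)).
    rewrite row_permE unitmx_mul unitmx_perm.
    by apply/(bdiag_unitP psum_m).
  by apply/matrixP=> a c; rewrite !mxE WE mxE eq_sym.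
exists (fun a => b (s a)); split=> // a; split.
- by have := bP (s a); lia.
- move=> j js; rewrite rowW (leading_row M0) // => [|c cj].
    rewrite [\row__ _](_ : _ = 0) ?mul0mx //; apply/rowP=> c; rewrite !mxE.
    by case: eqP => // cj; rewrite W0 //; lia.
  by rewrite mxE W0 //; lia.
- by have := unitmx_row_neq0 a uC; rewrite rowK.
Qed.
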